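(* For any instance of the minimum, sorting, or MST problem under uncertainty (with predictions), the hop distance is at least as large as the mandatory query distance: $k_M \leq k_h$.
   Context: Each uncertain element $i$ has an interval $I_i$ that is open $(L_i,U_i)$ or trivial $\{w_i\}$, an unknown true value $w_i\in I_i$ and a predicted value $\bar w_i\in I_i$. Minimum problem: given intervals $\mathcal{I}$ and a family $\mathcal{S}$ of subsets, determine for each $S\in\mathcal{S}$ an element of minimum true value. Sorting problem: determine for each $S\in\mathcal{S}$ the order of its elements by true value. MST problem: graph $G=(V,E)$ with an interval per edge weight; determine a spanning tree that is an MST for the true weights. A query reveals a true value; a query set $Q$ is feasible if the answer is the same for all value assignments in the intervals agreeing with the true values on $Q$. An element is mandatory if it belongs to every feasible query set (w.r.t. true values), and prediction mandatory if it belongs to every feasible query set when the true values are assumed to equal the predicted values. With $\mathcal{I}_R$ the set of mandatory and $\mathcal{I}_P$ the set of prediction mandatory elements, the mandatory query distance is $k_M=|\mathcal{I}_P\triangle\mathcal{I}_R|$. Hop distance: for a non-trivial $I_j=(L_j,U_j)$, the value of $I_i$ passes over $L_j$ if one of $w_i,\bar w_i$ is $\le L_j$ and the other is $>L_j$, and passes over $U_j$ if one of them is $<U_j$ and the other is $\ge U_j$; for a trivial $I_j=\{w_j\}$, the value of $I_i$ jumps over $I_j$ if one of $w_i,\bar w_i$ is $<w_j$ and the other $>w_j$. Let $A_i$ be the union of all sets of $\mathcal{S}$ containing $I_i$ (minimum and sorting problems), resp. the set of all edges lying on a cycle containing edge $i$ (MST problem). $h_i$ is the number of non-trivial $I_j\in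 A_i$ whose $L_j$ the value of $I_i$ passes over, plus the number of non-trivial $I_j\in A_i$ whose $U_j$ the value of $I_i$ passes over, plus the number of trivial $I_j\in A_i$ that the value of $I_i$ jumps over. The hop distance is $k_h=\sum_i h_i$. *)

(* Defs.v *)
From mathcomp Require Import all_boot all_order all_algebra.
From mathcomp Require Import boolp reals.

Set Implicit Arguments.
Unset Strict Implicit.
Unset Printing Implicit Defensive.

Import Order.TTheory GRing.Theory Num.Theory.
Local Open Scope ring_scope.

Variant uncertainty_interval (R : realType) :=
  | Open of R & R
  | Trivial of R.

Definition in_interval (R : realType) (J : uncertainty_interval R) (x : R) : Prop :=
  match J with
  | Open L U => L < x < U
  | Trivial v => x = v
  end.

Record uncertain_instance (R : realType) (T : finType) := UncertainInstance {
  interval_of : T -> uncertainty_interval R;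
  true_value : T -> R;
  predicted_value : T -> R;
  true_valueP : forall i, in_interval (interval_of i) (true_value i);
  predicted_valueP : forall i, in_interval (interval_of i) (predicted_value i)
}.

(* A problem is a relation [solves : (T -> R) ->
   A -> Prop]; [solves w a] says that the answer [a] is correct for the value
   assignment [w].  When several answers are correct (ties), feasibility asks
   for one common answer that is correct for every assignment. *)
Definition feasible (R : realType) (T : finType) (A : Type)
    (solves : (T -> R) -> A -> Prop) (J : T -> uncertainty_interval R)
    (v : T -> R) (Q : {set T}) : Prop :=
  exists a : A, forall w : T -> R,
    (forall i, in_interval (J i) (w i)) -> (forall i, i \in Q -> w i = v i) ->
    solves w a.

Definition mandatory (R : realType) (T : finType) (A : Type)
    (solves : (T -> R) -> A -> Prop) (J : T -> uncertainty_interval R)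
    (v : T -> R) : {set T} :=
  [set i | `[< forall Q : {set T}, feasible solves J v Q -> i \in Q >]].

Definition mandatory_query_distance (R : realType) (T : finType) (A : Type)
    (solves : (T -> R) -> A -> Prop) (I : uncertain_instance R T) : nat :=
  let I_R := mandatory solves (interval_of I) (true_value I) in
  let I_P := mandatory solves (interval_of I) (predicted_value I) in
  #|(I_P :\: I_R) :|: (I_R :\: I_P)|.

Definition passes_lower (R : realType) (T : finType)
    (I : uncertain_instance R T) (i j : T) : bool :=
  let w := true_value I i in let p := predicted_value I i in
  match interval_of I j with
  | Open L _ => (w <= L < p) || (p <= L < w)
  | Trivial _ => false
  end.

Definition passes_upper (R : realType) (T : finType)
    (I : uncertain_instance R T) (i j : T) : bool :=
  let w := true_value I i in let p := predicted_value I i in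
  match interval_of I j with
  | Open _ U => (w < U <= p) || (p < U <= w)
  | Trivial _ => false
  end.

Definition jumps_over (R : realType) (T : finType)
    (I : uncertain_instance R T) (i j : T) : bool :=
  let w := true_value I i in let p := predicted_value I i in
  match interval_of I j with
  | Open _ _ => false
  | Trivial v => (w < v < p) || (p < v < w)
  end.

Definition hop_distance (R : realType) (T : finType)
    (A : T -> {set T}) (I : uncertain_instance R T) : nat :=
  (\sum_(i : T) (#|[set j in A i | passes_lower I i j]|
               + #|[set j in A i | passes_upper I i j]|
               + #|[set j in A i | jumps_over I i j]|))%N.

Definition solves_minimum (R : realType) (T : finType) (Ss : {set {set T}})
    (w : T -> R) (a : {set T} -> T) : Prop :=
  forall S : {set T}, S \in Ss ->
    a S \in S /\ (forall j, j \in S -> w (a S) <= w j).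

Definition solves_sorting (R : realType) (T : finType) (Ss : {set {set T}})
    (w : T -> R) (a : {set T} -> seq T) : Prop :=
  forall S : {set T}, S \in Ss ->
    perm_eq (a S) (enum S) /\ sorted (fun x y => w x <= w y) (a S).

Definition family_neighbourhood (T : finType) (Ss : {set {set T}}) (i : T) :
    {set T} :=
  \bigcup_(S in Ss | i \in S) S.

(* Parallel edges are allowed; simple graphs are the case of an injective
   [ends]. *)
Record graph (V E : finType) := Graph {
  ends : E -> {set V};
  card_ends : forall e, #|ends e| = 2%N
}.

(* A cycle v_1, e_1, v_2, e_2, ..., v_k, e_k, v_1 is encoded as the sequence of
   the pairs (v_i, e_i); distinctness of the edges only matters for k = 2. *)
Definition is_cycle (V E : finType) (G : graph V E) (c : seq (V * E)) : bool :=
  [&& c != [::], uniq (unzip1 c), uniq (unzip2 c)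
    & cycle (fun p q => ends G p.2 == [set p.1; q.1]) c].

Definition spans (V E : finType) (G : graph V E) (F : {set E}) : Prop :=
  forall x y : V, connect (fun u v => [exists e in F, ends G e == [set u; v]]) x y.

Definition acyclic (V E : finType) (G : graph V E) (F : {set E}) : Prop :=
  forall c, is_cycle G c -> ~ {subset unzip2 c <= F}.

Definition spanning_tree (V E : finType) (G : graph V E) (F : {set E}) : Prop :=
  spans G F /\ acyclic G F.

Definition solves_mst (R : realType) (V E : finType) (G : graph V E)
    (w : E -> R) (F : {set E}) : Prop :=
  spanning_tree G F /\
  (forall F' : {set E}, spanning_tree G F' ->
     \sum_(e in F) w e <= \sum_(e in F') w e).

Definition cycle_neighbourhood (V E : finType) (G : graph V E) (i : E) :
    {set E} :=
  [set j | `[< exists c, [/\ is_cycle G c, i \in unzip2 c & j \in unzip2 c] >]].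

(* Main.v *)
Require Import Defs.
From mathcomp Require Import all_boot all_order all_algebra.
From mathcomp Require Import boolp reals.
From mathcomp Require Import lra.

Set Implicit Arguments.
Unset Strict Implicit.
Unset Printing Implicit Defensive.

Import Order.TTheory GRing.Theory Num.Theory.
Local Open Scope ring_scope.

(** Feasibility is monotone in the query set, so [i] is mandatory iff querying
    everything except [i] does not suffice.  For a trivial interval this only
    says that the instance has no solution.  For [I_i = (L, U)] it depends on the
    other values only through the comparisons [v j <= L] and [U <= v j], where
    [j] ranges over the elements with [i] in [A_j]: leaving [i] unqueried is
    harmless iff
    - minimum: in every set containing [i], all other values are [>= U] or one
      of them is [<= L];
    - sorting: in every set containing [i], no other value lies in [(L, U)];
    - MST: every cycle through [i] has another edge of value [>= U] (then some
      tree containing [i] is always optimal), or some cycle through [i] has all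
      its other edges of value [<= L] (then some tree avoiding [i] is).
    Hence if the status of [i] differs between the true and the predicted values,
    some [j] with [i] in [A_j] passes over [L_i] or [U_i], and distinct [i]
    are charged to distinct terms of the hop distance. *)

(** * Updated assignments and bounds over open intervals *)

Definition upd (R : realType) (T : finType) (v : T -> R) (i : T) (x : R) : T -> R :=
  fun j => if j == i then x else v j.

Section Values.
Variables (R : realType) (T : finType).
Implicit Types (v : T -> R) (i j : T) (L U x y : R).

Lemma upd_same v i x : upd v i x i = x.
Proof. by rewrite /upd eqxx. Qed.

Lemma upd_other v i x j : j != i -> upd v i x j = v j.
Proof. by rewrite /upd => /negPf ->. Qed.

(** Otherwise [y < U], and a midpoint exceeds [y]: that of [y] and [U] if [L < y], that of [L] and
    [U] if not. *)
Lemma open_ubound L U y : L < U -> (forall x, L < x < U -> x <= y) -> U <= y.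
Proof.
move=> LU H; rewrite leNgt; apply/negP => yU.
case: (lerP L y) => Ly.
  have: (y + U) / 2 <= y by apply: H; apply/andP; split; lra.
  by lra.
have: (L + U) / 2 <= y by apply: H; apply/andP; split; lra.
by lra.
Qed.

Lemma open_lbound L U y : L < U -> (forall x, L < x < U -> y <= x) -> y <= L.
Proof.
move=> LU H; rewrite -lerN2; apply: (@open_ubound (- U)); first by rewrite ltrN2.
by move=> x /andP[h1 h2]; rewrite lerNr; apply: H; apply/andP; split; lra.
Qed.

End Values.

(** * Mandatory elements through the query set that omits one element *)

Section Mandatory.
Variables (R : realType) (T : finType) (A : Type).
Variable solves : (T -> R) -> A -> Prop.
Implicit Types (J : T -> uncertainty_interval R) (v : T -> R).

Lemma mandatoryE J v i :
  (i \in mandatory solves J v) = ~~ `[< feasible solves J v [set~ i] >].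
Proof.
rewrite inE; apply/idP/idP => [/asboolP H|].
  by apply/negP => /asboolP /H; rewrite !inE eqxx.
move=> /asboolP H; apply/asboolP => Q [a Ha]; apply: contrapT => /negP iQ.
apply: H; exists a => w wJ wv; apply: Ha => // j jQ; apply: wv.
by rewrite !inE; apply: contraNneq iQ => <-.
Qed.

(** An assignment agreeing with [v] off [i] is an update of [v] at [i], so only one value remains
    free. *)
Lemma feasible_setC1 J v i : (forall j, in_interval (J j) (v j)) ->
  feasible solves J v [set~ i] <->
  exists a, forall x, in_interval (J i) x -> solves (upd v i x) a.
Proof.
move=> vJ; split=> -[a Ha]; exists a.
  move=> x xJ; apply: Ha => j.
    by rewrite /upd; case: eqP => [->|].
  by rewrite !inE => /upd_other ->.
move=> w wJ wv; have -> : w = upd v i (w i).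
  apply: funext => j; rewrite /upd; case: (eqVneq j i) => [->//|ji].
  by apply: wv; rewrite !inE.
exact: Ha.
Qed.

End Mandatory.

(** Both equalities hold exactly when moving from [v j] to [v' j] passes over neither [L] nor
    [U]. *)
Definition same_side (R : realType) (T : finType) (L U : R) (v v' : T -> R) (j : T) :=
  (v j <= L) = (v' j <= L) /\ (U <= v j) = (U <= v' j).

(** This is feasibility of [[set~ i]] when [I_i] is [(L, U)], stated without the other intervals. *)
Definition robust (R : realType) (T : finType) (A : Type)
    (solves : (T -> R) -> A -> Prop) (i : T) (L U : R) (v : T -> R) : Prop :=
  exists a, forall x, L < x < U -> solves (upd v i x) a.

(** * Charging changes of status to hops *)

Section Distance.
Variables (R : realType) (T : finType) (A : Type).
Variables (solves : (T -> R) -> A -> Prop) (I : uncertain_instance R T).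
Variable nb : T -> {set T}.

Lemma mandatory_distance_le_hop :
  (forall i, i \in mandatory solves (interval_of I) (true_value I)
             != (i \in mandatory solves (interval_of I) (predicted_value I)) ->
     exists2 j, i \in nb j & passes_lower I j i || passes_upper I j i) ->
  (mandatory_query_distance solves I <= hop_distance nb I)%N.
Proof.
move=> H; rewrite /mandatory_query_distance /hop_distance.
set D := (_ :|: _).
pose h i j : bool := (i \in nb j) && (passes_lower I j i || passes_upper I j i).
apply: (@leq_trans (\sum_i \sum_j h i j)%N).
  rewrite -sum1_card big_mkcond; apply: leq_sum => i _.
  case: ifP => // iD; have [|j nj pj] := H i.
    move: iD; rewrite !inE.
    by do 2 case: `[< _ >].
  by rewrite (bigD1 j) //= /h nj pj.
(* Regroup by the passing element [j]: a pair with at least one passing counts once here and at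
   least once in the hops of [j]. *)
rewrite exchange_big; apply: leq_sum => j _.
apply: leq_trans (leq_addr _ _).
rewrite -!sum1_card !(big_mkcond (fun k => k \in _)) -big_split /=.
apply: leq_sum => i _; rewrite !inE /h.
by case: (i \in _) => //=; case: passes_lower; case: passes_upper.
Qed.

(** The first hypothesis settles trivial intervals, where leaving [i] unqueried only requires a
    solution to exist. The second settles open ones: without a passing [j], robustness transfers
    both ways. *)
Lemma distance_le_hop_of_robust :
  (forall v v', (exists a, solves v a) -> exists a, solves v' a) ->
  (forall i L U v v', L < U -> (forall j, i \in nb j -> same_side L U v v' j) ->
     robust solves i L U v -> robust solves i L U v') ->
  (mandatory_query_distance solves I <= hop_distance nb I)%N.
Proof.
move=> Hsol Hrob; apply: mandatory_distance_le_hop => i.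
have trueJ := @true_valueP _ _ I; have predJ := @predicted_valueP _ _ I.
rewrite !mandatoryE (inj_eq negb_inj) => ne; apply: contrapT => none.
have : feasible solves (interval_of I) (true_value I) [set~ i] <->
       feasible solves (interval_of I) (predicted_value I) [set~ i].
  rewrite !feasible_setC1 //.
  move: (trueJ i) none; case Ji: (interval_of I i) => [L U|u] /= vi none.
    have LU : L < U by case/andP: vi; exact: lt_trans.
    have side j : i \in nb j -> same_side L U (true_value I) (predicted_value I) j.
      move=> ij; have : ~~ (passes_lower I j i || passes_upper I j i).
        by apply/negP => ?; apply: none; exists j.
      rewrite /passes_lower /passes_upper Ji /same_side.
      by do 2!case: lerP => ?; do 2!case: lerP => ?.
    split; apply: Hrob => // j /side[h1 h2]; split=> //.
  split=> -[a Ha].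
    have [b Hb] : exists b, solves (upd (predicted_value I) i u) b.
      by apply: Hsol; exists a; apply: Ha.
    by exists b => _ ->.
  have [b Hb] : exists b, solves (upd (true_value I) i u) b.
    by apply: Hsol; exists a; apply: Ha.
  by exists b => _ ->.
by move=> E; move/eqP: ne; apply; apply/asbool_equiv_eq.
Qed.

End Distance.

(** * The minimum and sorting problems *)

Section MinimumSorting.
Variables (R : realType) (T : finType) (Ss : {set {set T}}).
Implicit Types (v : T -> R) (i j : T) (S : {set T}).

Lemma mem_family_neighbourhood S i j : S \in Ss -> i \in S -> j \in S ->
  i \in family_neighbourhood Ss j.
Proof. by move=> SS iS jS; apply/bigcupP; exists S; rewrite ?SS. Qed.

Lemma exists_minimum v S : S != set0 ->
  exists2 k, k \in S & forall j, j \in S -> v k <= v j.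
Proof.
by case/set0Pn=> k0 k0S; case: (arg_minP v k0S) => k kS kmin; exists k.
Qed.

(** The right side does not mention [v]. A choice function is used instead of nonemptiness of the
    sets because an answer is a total function, which does not exist for empty [T]. *)
Lemma solvable_minimum v : (exists a, solves_minimum Ss v a) <->
  (exists a : {set T} -> T, forall S, S \in Ss -> a S \in S).
Proof.
split=> -[a Ha]; first by exists a => S /Ha[].
suff /choice[b Hb] : forall S, exists k, S \in Ss ->
    k \in S /\ (forall j, j \in S -> v k <= v j) by exists b.
move=> S; case: (boolP (S \in Ss)) => [SS|_]; last by exists (a S).
have [|k kS kmin] := @exists_minimum v S; last by exists k.
by apply/set0Pn; exists (a S); apply: Ha.
Qed.

(** An answer [i] for [S] must stay minimal as [x] tends to [U]; any other answer must stay below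
    [i] as [x] tends to [L]. *)
Lemma robust_minimum i L U v : L < U ->
  robust (solves_minimum Ss) i L U v <->
  forall S, S \in Ss -> S != set0 /\
    (i \in S -> (forall j, j \in S -> j != i -> U <= v j) \/
                (exists j, [/\ j \in S, j != i & v j <= L])).
Proof.
move=> LU; split=> [[a Ha] S SS|H].
  have LUm : L < (L + U) / 2 < U by apply/andP; split; lra.
  have [aS _] := Ha _ LUm _ SS.
  split=> [|iS]; first by apply/set0Pn; exists (a S).
  have [ai|ai] := eqVneq (a S) i; [left => j jS ji|right].
    apply: (open_ubound LU) => x /Ha /(_ _ SS)[_ /(_ _ jS)].
    by rewrite ai upd_same upd_other.
  exists (a S); split=> //; apply: (open_lbound LU) => x /Ha /(_ _ SS)[_ /(_ _ iS)].
  by rewrite upd_same upd_other.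
suff /choice[b Hb] : forall S, exists k, S \in Ss -> k \in S /\
    forall x, L < x < U -> forall j, j \in S -> upd v i x k <= upd v i x j.
  by exists b => x xLU S SS; have [bS bmin] := Hb _ SS; split=> // j; apply: bmin.
move=> S; case: (boolP (S \in Ss)) => [SS|_]; last by exists i.
have [S0 HS] := H _ SS; have [iS|iS] := boolP (i \in S); last first.
  have [k kS kmin] := exists_minimum v S0; exists k => _; split=> // x _ j jS.
  by rewrite !upd_other ?kmin //; apply: contraNneq iS => <-.
have [Hi|[k0 [k0S k0i k0L]]] := HS iS.
  exists i => _; split=> // x /andP[_ xU] j jS; rewrite upd_same.
  have [->|ji] := eqVneq j i; first by rewrite upd_same.
  by rewrite upd_other // (le_trans (ltW xU)) // Hi.
(* As [k0] has value at most [L], so has the minimum over [S :\ i], which is thus below every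
   [x]. *)
have [|k] := @exists_minimum v (S :\ i).
  by apply/set0Pn; exists k0; rewrite !inE k0i.
rewrite !inE => /andP[ki kS] kmin; exists k => _; split=> // x /andP[Lx _] j jS.
rewrite upd_other //; have [->|ji] := eqVneq j i; last first.
  by rewrite upd_other // kmin // !inE ji.
by rewrite upd_same (le_trans _ (ltW Lx)) // (le_trans _ k0L) // kmin // !inE k0i.
Qed.

Lemma minimum_distance_le_hop (I : uncertain_instance R T) :
  (mandatory_query_distance (solves_minimum Ss) I
     <= hop_distance (family_neighbourhood Ss) I)%N.
Proof.
apply: distance_le_hop_of_robust => [v v'|i L U v v' LU side].
  by rewrite !solvable_minimum.
rewrite !robust_minimum // => H S SS; have [S0 HS] := H _ SS; split=> // iS.
have side_in j : j \in S -> same_side L U v v' j.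
  by move=> jS; apply: side; apply: mem_family_neighbourhood jS.
have [Hi|[j [jS ji jL]]] := HS iS; [left=> j jS ji|right; exists j; split=> //].
  by have [_ <-] := side_in _ jS; apply: Hi.
by have [<- _] := side_in _ jS.
Qed.

Lemma robust_sorting i L U v : L < U ->
  robust (solves_sorting Ss) i L U v <->
  forall S j, S \in Ss -> i \in S -> j \in S -> j != i -> (v j <= L) || (U <= v j).
Proof.
move=> LU; split=> [[a Ha] S j SS iS jS ji|H].
  (* The common answer lists [i] before or after [j]; [y] refutes the former and [x] the latter. *)
  have ord x y : L < x < U -> L < y < U -> ~ (x < v j /\ v j < y).
    move=> xLU yLU [xv vy].
    have [pa sx] := Ha _ xLU _ SS; have [_ sy] := Ha _ yLU _ SS.
    have ia : i \in a S by rewrite (perm_mem pa) mem_enum.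
    have ja : j \in a S by rewrite (perm_mem pa) mem_enum.
    have trnx : transitive (fun k l => upd v i x k <= upd v i x l).
      by move=> ? ? ?; apply: le_trans.
    have trny : transitive (fun k l => upd v i y k <= upd v i y l).
      by move=> ? ? ?; apply: le_trans.
    have [lij|lji|eij] := ltngtP (index i (a S)) (index j (a S)).
    - have := sorted_ltn_index trny sy i j ia ja lij.
      by rewrite upd_same upd_other // leNgt vy.
    - have := sorted_ltn_index trnx sx j i ja ia lji.
      by rewrite upd_same upd_other // leNgt xv.
    - by move: ji; rewrite -(nth_index i ia) eij nth_index // eqxx.
  case: lerP => //= Lv; case: lerP => //= vU; exfalso.
  by apply: (ord ((L + v j) / 2) ((v j + U) / 2)); split || (apply/andP; split); lra.
(* The midpoint represents all of [(L, U)]: no other value in a set with [i] lies strictly inside,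
   so moving [i] there preserves every comparison. *)
pose m := upd v i ((L + U) / 2).
exists (fun S => sort (fun k l => m k <= m l) (enum S)) => x /andP[Lx xU] S SS.
split; first by rewrite perm_sort.
have : sorted (fun k l => m k <= m l) (sort (fun k l => m k <= m l) (enum S)).
  by apply: sort_sorted => k l; apply: le_total.
apply: (@sub_in_sorted _ (mem S)); last first.
  by apply/allP => k; rewrite mem_sort mem_enum.
move=> k l /= kS lS; rewrite /m /upd.
case: (eqVneq k i) kS => [->|ki] kS; case: (eqVneq l i) lS => [->|li] lS //.
  by have := H _ _ SS kS lS li; case/orP; lra.
by have := H _ _ SS lS kS ki; case/orP; lra.
Qed.

Lemma sorting_distance_le_hop (I : uncertain_instance R T) :
  (mandatory_query_distance (solves_sorting Ss) I
     <= hop_distance (family_neighbourhood Ss) I)%N.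
Proof.
apply: distance_le_hop_of_robust => [v v' _|i L U v v' LU side].
  exists (fun S => sort (fun k l => v' k <= v' l) (enum S)) => S _.
  split; first by rewrite perm_sort.
  by apply: sort_sorted => k l; apply: le_total.
rewrite !robust_sorting // => H S j SS iS jS ji.
have [|<- <-] := side j; first exact: mem_family_neighbourhood jS.
exact: H jS ji.
Qed.

End MinimumSorting.

(** * Cycles, closure and edge exchange in spanning trees *)

Section Graphs.
Variables (V E : finType) (G : graph V E).
Implicit Types (F D : {set E}) (e f : E) (c : seq (V * E)).

Definition adj F : rel V := fun u v => [exists e in F, ends G e == [set u; v]].

(** Membership of [e] in the closure of [F] in the cycle matroid of [G]. Quantifying over both ends
    avoids choosing an orientation of [e]. *)
Definition linked F e : Prop :=
  {in ends G e &, forall u v, connect (adj F) u v}.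

Lemma adj_sym F : symmetric (adj F).
Proof. by move=> u v; apply: eq_existsb => e; rewrite setUC. Qed.

Lemma linkedP F e u v : ends G e = [set u; v] ->
  linked F e <-> connect (adj F) u v.
Proof.
rewrite /linked => ->; split=> [H|cuv x y]; first by apply: H; rewrite ?set21 ?set22.
by move=> /set2P[] -> /set2P[] -> //; rewrite (sym_connect_sym (@adj_sym F)).
Qed.

Lemma endsE e : exists u v, ends G e = [set u; v] /\ u != v.
Proof.
by have /eqP/cards2P[u [v [uv ->]]] := card_ends G e; exists u, v.
Qed.

Lemma connect_linked F D u v : {in D, forall e, linked F e} ->
  connect (adj D) u v -> connect (adj F) u v.
Proof.
move=> DF; apply: connect_sub => x y /exists_inP[e eD /eqP He].
exact/(linkedP _ He)/DF.
Qed.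

Lemma linked_mem F e : e \in F -> linked F e.
Proof.
move=> eF; have [u [v [He _]]] := endsE e; apply/(linkedP _ He)/connect1.
by apply/exists_inP; exists e; rewrite ?He.
Qed.

Lemma linked_trans F D e : {in D, forall f, linked F f} ->
  linked D e -> linked F e.
Proof.
move=> DF; have [u [v [He _]]] := endsE e.
by move=> /(linkedP _ He) cD; apply/(linkedP _ He); apply: connect_linked cD.
Qed.

Lemma linkedS F D e : D \subset F -> linked D e -> linked F e.
Proof. by move=> /subsetP DF; apply: linked_trans => f /DF/linked_mem. Qed.

Lemma spans_linked F D : {in D, forall f, linked F f} -> spans G D -> spans G F.
Proof. by move=> DF sD x y; apply: connect_linked (sD x y). Qed.

Lemma linked_spans F e : spans G F -> linked F e.
Proof. by move=> sF; have [u [v [He _]]] := endsE e; apply/(linkedP _ He)/sF. Qed.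

Local Notation step := (fun p q : V * E => ends G p.2 == [set p.1; q.1]).

(** Each pair carries the edge leaving its vertex, so the edge of the last pair [q] is not
    traversed. *)
Lemma path_connect F p s q : path step p (rcons s q) ->
  {subset unzip2 (p :: s) <= F} -> connect (adj F) p.1 q.1.
Proof.
elim: s p => [|r s IH] p /= /andP[pr ps] sub.
  by apply/connect1/exists_inP; exists p.2 => //; apply: sub; rewrite inE.
apply: (@connect_trans _ _ r.1).
  by apply/connect1/exists_inP; exists p.2 => //; apply: sub; rewrite inE eqxx.
by apply: IH => // e ein; apply: sub; rewrite inE ein orbT.
Qed.

Lemma cycle_linked c e : is_cycle G c -> e \in unzip2 c ->
  linked [set f in unzip2 c | f != e] e.
Proof.
case/and4P=> _ _ uE cyc /mapP[[x e'] pc ->] /=.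
have [n s rs] := rot_to pc.
have : {subset unzip2 s <= [set f in unzip2 c | f != e']}.
  move=> f fs; rewrite inE.
  have -> : f \in unzip2 c.
    by rewrite -(mem_rot n) -map_rot rs /= inE fs orbT.
  move: uE; rewrite -(rot_uniq n) -map_rot rs /= => /andP[ns _].
  by apply: contraNneq ns => <-.
move: cyc; rewrite -(rot_cycle n) rs /=.
(* A cycle with a single pair would be a loop, which [card_ends] excludes. *)
case: s {rs} => [|q s] /=.
  rewrite andbT => /eqP He; have := card_ends G e'.
  by rewrite He setUid cards1.
case/andP=> /eqP He ps sub; apply/(linkedP _ He).
rewrite (sym_connect_sym (@adj_sym _)).
exact: (path_connect ps).
Qed.

(** The clause on ends keeps the edges distinct in the induction. In the last clause [q] and [z] are
    arbitrary so that one closing pair can serve as both. *)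
Lemma path_edges F u p : path (adj F) u p -> uniq (u :: p) ->
  exists c, [/\ unzip1 c = belast u p, uniq (unzip2 c),
    {subset unzip2 c <= F},
    {in unzip2 c, forall e, {subset ends G e <= u :: p}}
    & forall q z, ends G q.2 = [set q.1; u] -> z.1 = last u p ->
        path step q (rcons c z)].
Proof.
elim: p u => [|y p IH] u.
  by move=> _ _; exists [::]; split=> //= q z -> ->; rewrite eqxx.
rewrite [path _ _ _]/= [uniq _]/=.
move=> /andP[/exists_inP[e eF /eqP He] py] /andP[uyp uy].
have [c [c1 c2 cF cends cpath]] := IH y py uy.
exists ((u, e) :: c); split=> /=.
- by rewrite c1.
- rewrite c2 andbT; apply/negP => /cends /(_ u).
  by rewrite He set21 (negPf uyp) => /(_ isT).
- by move=> f; rewrite inE => /predU1P[->//|/cF].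
- move=> f; rewrite inE => /predU1P[->|fc] x.
    by rewrite He => /set2P[] ->; rewrite !inE eqxx ?orbT.
  by move=> /(cends _ fc) xp; rewrite inE xp orbT.
- move=> q z -> zl; rewrite eqxx /=.
  exact: (cpath (u, e)).
Qed.

Lemma linked_cycle F e : e \notin F -> linked F e ->
  exists c, [/\ is_cycle G c, e \in unzip2 c & {subset unzip2 c <= e |: F}].
Proof.
move=> eF; have [u [v [He uv]]] := endsE e.
move=> /(linkedP _ He) /connectP[p0 p0p vE].
(* A simple path between the ends of [e], closed by [e], is the cycle. *)
move: He uv; rewrite {v}vE; case/shortenP: p0p => p pp up _ He uv.
have [c [c1 c2 cF _ cpath]] := path_edges pp up.
exists ((last u p, e) :: c); split=> /=; last 1 first.
- by move=> f; rewrite !inE => /predU1P[->|/cF ->]; rewrite ?eqxx ?orbT.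
- rewrite /is_cycle /= c1 c2 andbT -rcons_uniq -lastI up.
  rewrite cpath //= ?andbT; last by rewrite setUC.
  by apply: contra eF => /cF.
- by rewrite inE eqxx.
Qed.

(** Matroid exchange: a cycle closes [e] over [f |: F]. It must use [f], or [e] would be linked by
    [F]; its other edges then link [f]. *)
Lemma linked_exchange F e f : e \notin F -> e != f ->
  linked (f |: F) e -> ~ linked F e -> linked (e |: F) f.
Proof.
move=> eF ef /linked_cycle[|c [cyc ec cF] nl].
  by rewrite !inE negb_or ef.
have [fc|fc] := boolP (f \in unzip2 c).
  apply: linkedS (cycle_linked cyc fc); apply/subsetP => g.
  by rewrite !inE => /andP[/cF]; rewrite !inE => /or3P[]-> //= ; rewrite ?orbT.
exfalso; apply: nl; apply: linkedS (cycle_linked cyc ec); apply/subsetP => g.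
rewrite inE => /andP[gc]; have := cF _ gc; rewrite !inE => /or3P[->//|/eqP gf|->//].
by rewrite -gf gc in fc.
Qed.

Lemma acyclic_linked F e : acyclic G F -> e \in F -> ~ linked (F :\ e) e.
Proof.
move=> aF eF /linked_cycle[|c [cyc _ cF]]; first by rewrite !inE eqxx.
by apply: (aF c cyc) => f /cF; rewrite setD1K.
Qed.

Lemma acyclic_swap F e f : acyclic G F -> ~ linked (F :\ f) e ->
  acyclic G (e |: F :\ f).
Proof.
move=> aF nl c cyc cF; have [ec|ec] := boolP (e \in unzip2 c).
  apply: nl; apply: linkedS (cycle_linked cyc ec); apply/subsetP => g.
  by rewrite inE => /andP[/cF]; rewrite in_setU1 => /predU1P[->|//]; rewrite eqxx.
apply: (aF c cyc) => g gc; have := cF _ gc; rewrite !inE => /predU1P[ge|/andP[]//].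
by rewrite -ge gc in ec.
Qed.

(** This is the fundamental cycle of [e]. The rest of it links each removed [f]; and if [F :\ f]
    linked [e], it would link [f] too, contradicting acyclicity. *)
Lemma tree_insert F e : spanning_tree G F -> e \notin F ->
  exists c, [/\ is_cycle G c, e \in unzip2 c
    & {in unzip2 c, forall f, f != e -> f \in F /\ spanning_tree G (e |: F :\ f)}].
Proof.
move=> [sF aF] eF; have [c [cyc ec cF]] := linked_cycle eF (@linked_spans _ e sF).
exists c; split=> // f fc fe.
have fF : f \in F by have := cF _ fc; rewrite in_setU1 (negPf fe).
have lf : linked (e |: F :\ f) f.
  apply: linkedS (cycle_linked cyc fc); apply/subsetP => g.
  by rewrite !inE => /andP[/cF]; rewrite !inE => /orP[]-> ->; rewrite ?orbT.
split=> //; split.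
  apply: spans_linked sF => g gF; have [->//|gf] := eqVneq g f.
  by apply: linked_mem; rewrite !inE gf gF orbT.
apply: acyclic_swap => // le; apply: (acyclic_linked aF fF).
by apply: linked_trans lf => g /setU1P[->//|/linked_mem].
Qed.

(** If [F :\ e] linked every other edge of the cycle, it would link [e] by transitivity. An edge [f]
    it does not link reconnects the tree by exchange. *)
Lemma tree_remove F e c : spanning_tree G F -> e \in F -> is_cycle G c ->
  e \in unzip2 c -> exists f, [/\ f \in unzip2 c, f != e, f \notin F
    & spanning_tree G (f |: F :\ e)].
Proof.
move=> [sF aF] eF cyc ec; have nle := acyclic_linked aF eF.
have [f fc nlf] : exists2 f, f \in [set f in unzip2 c | f != e] & ~ linked (F :\ e) f.
  apply: contrapT => none; apply: nle; apply: linked_trans (cycle_linked cyc ec).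
  by move=> f fc; apply: contrapT => nl; apply: none; exists f.
move: fc; rewrite inE => /andP[fc fe]; exists f.
have fFe : f \notin F :\ e by apply/negP => /linked_mem.
have fF : f \notin F by move: fFe; rewrite !inE fe.
split=> //; split; last exact: acyclic_swap.
have le : linked (f |: F :\ e) e.
  by apply: linked_exchange => //; rewrite setD1K //; apply: linked_spans.
apply: spans_linked sF => g gF; have [->//|ge] := eqVneq g e.
by apply: linked_mem; rewrite !inE ge gF orbT.
Qed.

End Graphs.

(** * The minimum spanning tree problem *)

Section Mst.
Variables (R : realType) (V E : finType) (G : graph V E).
Implicit Types (v w : E -> R) (i j : E) (F : {set E}) (c : seq (V * E)).

Lemma mem_cycle_neighbourhood c i j : is_cycle G c -> i \in unzip2 c ->
  j \in unzip2 c -> i \in cycle_neighbourhood G j.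
Proof. by move=> cyc ic jc; rewrite inE; apply/asboolP; exists c. Qed.

Lemma solvable_mst w :
  (exists F, solves_mst G w F) <-> (exists F, spanning_tree G F).
Proof.
split=> [[F [tF _]]|[F0 tF0]]; first by exists F.
pose tree := [pred F : {set E} | `[< spanning_tree G F >]].
have P0 : tree F0 by apply/asboolP.
have [F /asboolP tF Fmin] := @arg_minP _ _ _ F0 tree (fun F => \sum_(e in F) w e) P0.
by exists F; split=> // F' tF'; apply: Fmin; apply/asboolP.
Qed.

Lemma weight_swap w F i j : i \notin F -> j \in F ->
  \sum_(e in i |: F :\ j) w e = \sum_(e in F) w e + w i - w j.
Proof.
move=> iF jF; rewrite big_setU1 ?inE ?(negPf iF) ?andbF //=.
by rewrite [in RHS](big_setD1 j) //=; lra.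
Qed.

Lemma weight_upd v F i x y :
  \sum_(e in F) upd v i x e
    = \sum_(e in F) upd v i y e + (if i \in F then x - y else 0).
Proof.
have other (D : {set E}) : i \notin D ->
    \sum_(e in D) upd v i x e = \sum_(e in D) upd v i y e.
  move=> iD; apply: eq_bigr => e eD.
  by rewrite !upd_other //; apply: contraNneq iD => <-.
case: ifPn => iF; last by rewrite other ?addr0.
rewrite !(big_setD1 i iF) /= !upd_same other ?inE ?eqxx //; lra.
Qed.

(** The weight of [F] drops by [y - x], that of any other tree by at most as much. *)
Lemma mst_decrease v F i x y : i \in F -> x <= y ->
  solves_mst G (upd v i y) F -> solves_mst G (upd v i x) F.
Proof.
move=> iF xy [tF Fmin]; split=> // F' /Fmin.
by rewrite !(weight_upd v _ i x y) iF; case: ifP => _; lra.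
Qed.

Lemma mst_increase v F i x y : i \notin F -> y <= x ->
  solves_mst G (upd v i y) F -> solves_mst G (upd v i x) F.
Proof.
move=> iF xy [tF Fmin]; split=> // F' /Fmin.
by rewrite !(weight_upd v _ i x y) (negPf iF); case: ifP => _; lra.
Qed.

Lemma robust_mst i L U v : L < U ->
  robust (solves_mst G) i L U v <->
  (exists F, spanning_tree G F) /\
  ((forall c, is_cycle G c -> i \in unzip2 c ->
      exists j, [/\ j \in unzip2 c, j != i & U <= v j]) \/
   (exists c, [/\ is_cycle G c, i \in unzip2 c
      & forall j, j \in unzip2 c -> j != i -> v j <= L])).
Proof.
move=> LU; split=> [[F HF]|[tree cond]].
  have tF : spanning_tree G F.
    by have [|] := HF ((L + U) / 2); first by apply/andP; split; lra.
  split; first by exists F.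
  (* The swaps bound [v j] by comparing [F], optimal for all [x], with its neighbouring trees. *)
  have [iF|iF] := boolP (i \in F); [left=> c cyc ic|right].
    have [j [jc ji jF tF']] := tree_remove tF iF cyc ic.
    exists j; split=> //; apply: (open_ubound LU) => x /HF[_ /(_ _ tF')].
    by rewrite weight_swap // upd_same upd_other //; lra.
  have [c [cyc ic swap]] := tree_insert tF iF.
  exists c; split=> // j jc ji; have [jF tF'] := swap j jc ji.
  apply: (open_lbound LU) => x /HF[_ /(_ _ tF')].
  by rewrite weight_swap // upd_same upd_other //; lra.
case: cond => [Hc|[c [cyc ic cL]]].
  (* A tree containing [i] that is optimal at the endpoint [U] stays optimal for all smaller [x]. *)
  suff [F [iF HF]] : exists F, i \in F /\ solves_mst G (upd v i U) F.
    by exists F => x /andP[_ /ltW xU]; apply: mst_decrease HF.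
  have [F HF] := (solvable_mst (upd v i U)).2 tree.
  have [iF|iF] := boolP (i \in F); first by exists F.
  have [c [cyc ic swap]] := tree_insert HF.1 iF.
  have [j [jc ji Uj]] := Hc c cyc ic; have [jF tF'] := swap j jc ji.
  (* At weight [U], replacing [j] of value at least [U] by [i] does not increase the total. *)
  exists (i |: F :\ j); rewrite setU11; split=> //; split=> // F' /HF.2.
  by rewrite weight_swap // upd_same upd_other //; lra.
(* Dually, a tree avoiding [i] that is optimal at [L] stays optimal for all larger [x]. *)
suff [F [iF HF]] : exists F, i \notin F /\ solves_mst G (upd v i L) F.
  by exists F => x /andP[/ltW Lx _]; apply: mst_increase HF.
have [F HF] := (solvable_mst (upd v i L)).2 tree.
have [iF|iF] := boolP (i \in F); last by exists F.
have [j [jc ji jF tF']] := tree_remove HF.1 iF cyc ic.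
exists (j |: F :\ i); rewrite !inE eqxx orbF eq_sym ji; split=> //.
split=> // F' /HF.2; have := cL j jc ji.
by rewrite weight_swap // upd_same upd_other //; lra.
Qed.

Lemma mst_distance_le_hop (I : uncertain_instance R E) :
  (mandatory_query_distance (solves_mst G) I
     <= hop_distance (cycle_neighbourhood G) I)%N.
Proof.
apply: distance_le_hop_of_robust => [v v'|i L U v v' LU side].
  by rewrite !solvable_mst.
have side_in c j : is_cycle G c -> i \in unzip2 c -> j \in unzip2 c ->
    same_side L U v v' j.
  by move=> cyc ic jc; apply: side; apply: mem_cycle_neighbourhood jc.
rewrite !robust_mst // => -[tree [Hc|[c [cyc ic cL]]]]; split=> //; [left|right].
  move=> c cyc ic; have [j [jc ji Uj]] := Hc c cyc ic; exists j; split=> //.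
  by have [_ <-] := side_in c j cyc ic jc.
exists c; split=> // j jc ji.
by have [<- _] := side_in c j cyc ic jc; apply: cL.
Qed.

End Mst.

Theorem theorem2 (R : realType) (T : finType) (I : uncertain_instance R T) :
  [/\ forall Ss : {set {set T}},
        (mandatory_query_distance (solves_minimum Ss) I
           <= hop_distance (family_neighbourhood Ss) I)%N,
      forall Ss : {set {set T}},
        (mandatory_query_distance (solves_sorting Ss) I
           <= hop_distance (family_neighbourhood Ss) I)%N
    & forall (V : finType) (G : graph V T),
        (mandatory_query_distance (solves_mst G) I
           <= hop_distance (cycle_neighbourhood G) I)%N].
Proof.
split=> [Ss|Ss|V G].
- exact: minimum_distance_le_hop.
- exact: sorting_distance_le_hop.
- exact: mst_distance_le_hop.
Qed.
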